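(* Let $\mathcal{B}=(\mathcal{O},\mathscr{C},\mathfrak{R},I,T)$ be a bud generating system such that $\mathcal{O}$ is a locally finite operad and $\mathfrak{R}(1)$ finitely factorizes $\mathbf{Bud}_{\mathscr{C}}(\mathcal{O})$. Then the syntactic generating series of $\mathcal{B}$ satisfies $$\mathrm{synt}(\mathcal{B})=\sum_{\substack{\mathfrak{t}\in\mathbf{Free}(\mathfrak{R})\\ \mathrm{out}(\mathfrak{t})\in I\\ \mathrm{in}(\mathfrak{t})\in T^+}}\mathrm{ev}_{\mathbf{Bud}_{\mathscr{C}}(\mathcal{O})}(\mathfrak{t}).$$
   Context: Colored operads. Let $\mathscr{C}$ be a finite set of colors. A $\mathscr{C}$-colored operad $\mathcal{C}=\bigsqcup_{n\geq1}\mathcal{C}(n)$ is a nonsymmetric colored set-operad: each $x\in\mathcal{C}(n)$ has arity $|x|=n$, an output color $\mathrm{out}(x)\in\mathscr{C}$ and a word of input colors $\mathrm{in}(x)\in\mathscr{C}^n$ with $i$-th letter $\mathrm{in}_i(x)$; $x\circ_i y\in\mathcal{C}(|x|+|y|-1)$ is defined iff $\mathrm{out}(y)=\mathrm{in}_i(x)$; there are units $\mathbf{1}_a\in\mathcal{C}(1)$, $a\in\mathscr{C}$, with output and input color $a$; the usual associativity and unit axioms hold. The complete composition is $x\circ[y_1,\dots,y_n]:=(\cdots((x\circ_n y_n)\circ_{n-1}y_{n-1})\cdots)\circ_1 y_1$ (defined when $\mathrm{out}(y_i)=\mathrm{in}_i(x)$ for all $i$). A (monochrome) operad is the case of a single color.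 $\mathcal{C}$ is locally finite if every $\mathcal{C}(n)$ is finite. Bud operads. For an operad $\mathcal{O}$ with unit $\mathbf{1}$, $\mathbf{Bud}_{\mathscr{C}}(\mathcal{O})$ is the $\mathscr{C}$-colored operad of triples $(a,x,u)\in\mathscr{C}\times\mathcal{O}(n)\times\mathscr{C}^n$, $n\geq1$, with output color $a$, input colors $u$, units $\mathbf{1}_a=(a,\mathbf{1},a)$, and $(a,x,u)\circ_i(b,y,v)=(a,x\circ_i y,u')$ when $b=u_i$, where $u'$ is $u$ with its $i$-th letter replaced by $v$. A bud generating system is a tuple $(\mathcal{O},\mathscr{C},\mathfrak{R},I,T)$ with $\mathcal{O}$ an operad, $\mathscr{C}$ a finite set of colors, $\mathfrak{R}$ a finite subset of $\mathbf{Bud}_{\mathscr{C}}(\mathcal{O})$ (rules) and $I,T\subseteq\mathscr{C}$. $T^+$ is the set of nonempty words on $T$. Trees. For a subset $S$ of a $\mathscr{C}$-colored operad $\mathcal{C}$, $S(1)$ is the set of its elements of arity $1$, and $\mathbf{Free}(S)$ is the set of $\mathscr{C}$-colored $S$-syntax trees: planar rooted trees whose internal nodes with $n\geq1$ children are labeled by arity-$n$ elements of $S$, such that if $v$ is the $i$-th child of $u$ (both internal) then the output color of the label of $v$ is the $i$-th input color of the label of $u$; it contains, for each color $a$, a tree consisting of one leaf with output and input color $a$. $\mathrm{out}(\mathfrak{t})$ is the output color of the root label, and $\mathrm{in}(\mathfrak{t})$ is the word of input colors of the leaves from left to right. The evaluation $\mathrm{ev}_{\mathcal{C}}(\mathfrak{t})\in\mathcal{C}$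 is obtained by composing in $\mathcal{C}$ the labels along $\mathfrak{t}$ (the one-leaf tree of color $a$ evaluates to $\mathbf{1}_a$). $S$ finitely factorizes $\mathcal{C}$ if for each $x\in\mathcal{C}$ there are finitely many $\mathfrak{t}\in\mathbf{Free}(S)$ with $\mathrm{ev}_{\mathcal{C}}(\mathfrak{t})=x$. Series. $\mathbb{K}$ is a field of characteristic zero. A $\mathcal{C}$-series is a map $\mathbf{f}:\mathcal{C}\to\mathbb{K}$, with values denoted $\langle x,\mathbf{f}\rangle$, written $\mathbf{f}=\sum_{x}\langle x,\mathbf{f}\rangle x$. The characteristic series of a subset is its indicator function. $\mathbf{u}$ is the characteristic series of $\{\mathbf{1}_a:a\in\mathscr{C}\}$. Composition product: $\langle x,\mathbf{f}\odot\mathbf{g}\rangle:=\sum_{y,z_1,\dots,z_{|y|}\in\mathcal{C},\,x=y\circ[z_1,\dots,z_{|y|}]}\langle y,\mathbf{f}\rangle\prod_{i}\langle z_i,\mathbf{g}\rangle$; on a locally finite colored operad it is associative with unit $\mathbf{u}$. The $\odot$-inverse $\mathbf{f}^{\odot_{-1}}$ of $\mathbf{f}$, when it exists, is the unique series $\mathbf{x}$ with $\mathbf{f}\odot\mathbf{x}=\mathbf{u}=\mathbf{x}\odot\mathbf{f}$. Let $\mathbf{r}$, $\mathbf{i}$, $\mathbf{t}$ be the characteristic series of $\mathfrak{R}$, $\{\mathbf{1}_a:a\in I\}$, $\{\mathbf{1}_a:a\in T\}$ in $\mathbf{Bud}_{\mathscr{C}}(\mathcal{O})$. The syntactic generating series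 is the $\mathbf{Bud}_{\mathscr{C}}(\mathcal{O})$-series $\mathrm{synt}(\mathcal{B}):=\mathbf{i}\odot(\mathbf{u}-\mathbf{r})^{\odot_{-1}}\odot\mathbf{t}$ (well-defined under the hypotheses of the claim). *)

(* Defs.v *)
From HB Require Import structures.
From mathcomp Require Import all_boot all_order all_algebra.
From mathcomp Require Import all_classical.
From mathcomp Require Import zify.

Set Implicit Arguments.
Unset Strict Implicit.
Unset Printing Implicit Defensive.

Import GRing.Theory.
Local Open Scope classical_set_scope.
Local Open Scope ring_scope.

Definition subst_letter (A : Type) (u : seq A) (i : nat) (v : seq A) : seq A :=
  take i u ++ v ++ drop i.+1 u.

(* The carrier is the disjoint union of the components C(n), n >= 1; the arity
   of x is the length of its input word.  Positions are numbered from 0.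
   Partial composition is a total function whose value is meaningful only when
   out y is the i-th input color of x (in particular i < arity x); all axioms
   are guarded by this condition. *)
Record coperad (C : finType) := Coperad {
  carrier :> choiceType;
  out : carrier -> C;
  inp : carrier -> seq C;
  pcomp : carrier -> nat -> carrier -> carrier;
  one : C -> carrier;
  inp_gt0 : forall x, (0 < size (inp x))%N;
  out_pcomp : forall x i y, onth (inp x) i = Some (out y) ->
    out (pcomp x i y) = out x;
  inp_pcomp : forall x i y, onth (inp x) i = Some (out y) ->
    inp (pcomp x i y) = subst_letter (inp x) i (inp y);
  out_one : forall a, out (one a) = a;
  inp_one : forall a, inp (one a) = [:: a];
  pcomp_series : forall x i y j z,
    onth (inp x) i = Some (out y) -> onth (inp y) j = Some (out z) ->
    pcomp (pcomp x i y) (i + j)%N z = pcomp x i (pcomp y j z);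
  pcomp_parallel : forall x i y j z, (i < j)%N ->
    onth (inp x) i = Some (out y) -> onth (inp x) j = Some (out z) ->
    pcomp (pcomp x j z) i y = pcomp (pcomp x i y) (j + (size (inp y)).-1)%N z;
  pcomp_onel : forall x, pcomp (one (out x)) 0 x = x;
  pcomp_oner : forall x i a, onth (inp x) i = Some a ->
    pcomp x i (one a) = x }.

Arguments one {C c} a.

Definition operad := coperad unit.

Section ColoredOperad.
Variables (C : finType) (O : coperad C).

Definition arity (x : O) : nat := size (inp x).

Definition locally_finite := forall n, finite_set [set x : O | arity x = n].

(* (...((x o_n y_n) o_(n-1) y_(n-1)) ...) o_1 y_1, for ys = [:: y_1; ...; y_n] *)
Definition ccomp (x : O) (ys : seq O) : O :=
  foldr (fun iy acc => pcomp acc iy.1 iy.2) x (zip (iota 0 (size ys)) ys).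

Definition units : set O := range (@one C O).

Definition units_in (A : {set C}) : set O := [set one a | a in [set` A]].

Definition arity1 (S : set O) : set O := S `&` [set x | arity x = 1%N].

End ColoredOperad.

Arguments units {C} O _.
Arguments units_in {C} O A _.
Arguments arity1 {C O} S _.

(* Raw planar trees; the color of a leaf which is a child of a node is
   determined by the label of that node when the tree is in Free S. *)
Inductive tree (C X : Type) : Type :=
| Leaf of C
| Node of X & seq (tree C X).

Arguments Leaf {C X} a.
Arguments Node {C X} x ts.

HB.instance Definition _ (C X : Type) := gen_eqMixin (tree C X).
HB.instance Definition _ (C X : Type) := gen_choiceMixin (tree C X).

Section Trees.
Variables (C : finType) (O : coperad C).
Implicit Types (S : set O) (t : tree C O).

Definition tout t : C :=
  match t with Leaf a => a | Node s _ => out s end.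

Fixpoint tin t : seq C :=
  match t with Leaf a => [:: a] | Node _ ts => flatten (map tin ts) end.

Fixpoint ev t : O :=
  match t with Leaf a => one a | Node s ts => ccomp s (map ev ts) end.

(* For a subtree, tout ti is the color of a leaf or the output color of the
   root label, so map tout ts = inp s forces both the number of children and
   the colors along the edges. *)
Inductive Free S : tree C O -> Prop :=
| FreeLeaf a : Free S (Leaf a)
| FreeNode s ts : S s -> map tout ts = inp s ->
    (forall t, t \in ts -> Free S t) -> Free S (Node s ts).

Definition finitely_factorizes S :=
  forall x : O, finite_set [set t | Free S t /\ ev t = x].

End Trees.

Section Series.
Variables (K : fieldType) (C : finType) (O : coperad C).

Definition opseries := O -> K.

Definition char_series (A : set O) : opseries := fun x => (x \in A)%:R.

Definition useries : opseries := char_series (units O).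

(* The index set consists of the pairs (y, [:: z_1; ...; z_|y|]) such that
   y o [z_1, ..., z_|y|] is defined and equal to x; it is finite when O is
   locally finite. *)
Definition oprod (f g : opseries) : opseries := fun x =>
  \sum_(p \in [set p : O * seq O |
                map (@out C O) p.2 = inp p.1 /\ ccomp p.1 p.2 = x])
    (f p.1 * \prod_(z <- p.2) g z).

Definition is_oinv (f g : opseries) :=
  oprod f g = useries /\ oprod g f = useries.

(* zero series if f has no inverse *)
Definition oinv (f : opseries) : opseries :=
  xget (fun=> 0 : K) [set g | is_oinv f g].

Definition summable_family (J : choiceType) (A : set J) (e : J -> O) :=
  forall x : O, finite_set [set j | A j /\ e j = x].

(* the formal sum of the elements e j, j in A *)
Definition sum_family (J : choiceType) (A : set J) (e : J -> O) : opseries :=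
  fun x => \sum_(j \in A) char_series [set e j] x.

End Series.

Arguments useries {K C O}.

Section SubstLetter.
Variable A : eqType.
Implicit Types (u v w : seq A).

Lemma subst_letter_cat u1 a u2 v :
  subst_letter (u1 ++ a :: u2) (size u1) v = u1 ++ v ++ u2.
Proof.
by rewrite /subst_letter take_size_cat // -cat_rcons drop_size_cat ?size_rcons.
Qed.

Lemma onth_split u i a : onth u i = Some a ->
  exists u1 u2, u = u1 ++ a :: u2 /\ size u1 = i.
Proof.
elim: u i => [|b u IH] [|i] //= => [[<-]|/IH [u1 [u2 [-> <-]]]].
  by exists [::], u.
by exists (b :: u1), u2.
Qed.

Lemma subst_letter_series u i a v j b w :
  onth u i = Some a -> onth v j = Some b ->
  subst_letter (subst_letter u i v) (i + j) w =
  subst_letter u i (subst_letter v j w).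
Proof.
move=> /onth_split[u1 [u2 [-> <-]]] /onth_split[v1 [v2 [-> <-]]].
rewrite !subst_letter_cat -catA /= [u1 ++ v1 ++ _]catA -size_cat.
by rewrite subst_letter_cat -!catA.
Qed.

Lemma subst_letter_parallel u i a v j b w : (i < j)%N -> (0 < size v)%N ->
  onth u i = Some a -> onth u j = Some b ->
  subst_letter (subst_letter u j w) i v =
  subst_letter (subst_letter u i v) (j + (size v).-1) w.
Proof.
move=> ij v0 /onth_split[u1 [u2 [-> su1]]]; rewrite onth_cat su1 ltnNge ltnW //=.
rewrite -[(j - i)%N]prednK ?subn_gt0 //= => /onth_split[v1 [v2 [-> sv1]]].
have -> : j = size (u1 ++ a :: v1).
  by rewrite size_cat /= sv1 su1 prednK ?subn_gt0 // subnKC // ltnW.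
have -> : u1 ++ a :: v1 ++ b :: v2 = (u1 ++ a :: v1) ++ b :: v2.
  by rewrite -catA.
rewrite subst_letter_cat -!catA !cat_cons -su1 !subst_letter_cat.
have -> : (size (u1 ++ a :: v1) + (size v).-1)%N = size (u1 ++ v ++ v1).
  by rewrite !size_cat /=; lia.
have -> : u1 ++ v ++ v1 ++ b :: v2 = (u1 ++ v ++ v1) ++ b :: v2.
  by rewrite -!catA.
by rewrite subst_letter_cat -!catA.
Qed.

Lemma size_subst_letter u i v : (i < size u)%N ->
  size (subst_letter u i v) = (i + size v + (size u - i.+1))%N.
Proof. by move=> iu; rewrite !size_cat size_takel ?size_drop ?addnA // ltnW. Qed.

Lemma subst_letter1 u i a : onth u i = Some a -> subst_letter u i [:: a] = u.
Proof. by move=> /onth_split[u1 [u2 [-> <-]]]; rewrite subst_letter_cat. Qed.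

End SubstLetter.

Section Bud.
Variables (C : finType) (O : operad).

(* Triples (a, x, u), with u of length the arity of x. *)
Definition bud_elt := {p : C * O * seq C | size p.2 == arity p.1.2}.

HB.instance Definition _ := Choice.on bud_elt.

Implicit Types X Y Z : bud_elt.

Definition bud_out X : C := (val X).1.1.
Definition bud_op X : O := (val X).1.2.
Definition bud_inp X : seq C := (val X).2.

(* The default value X of insubd is only returned when the composition is
   undefined. *)
Definition bud_pcomp X (i : nat) Y : bud_elt :=
  insubd X (bud_out X, pcomp (bud_op X) i (bud_op Y),
            subst_letter (bud_inp X) i (bud_inp Y)).

Lemma bud_one_subproof (a : C) :
  size [:: a] == arity (one tt : O).
Proof. by rewrite /arity inp_one. Qed.

Definition bud_one (a : C) : bud_elt :=
  exist _ (a, one tt, [:: a]) (bud_one_subproof a).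

Lemma size_bud_inp X : size (bud_inp X) = size (inp (bud_op X)).
Proof. exact/eqP/(valP X). Qed.

Lemma bud_composable X i Y : onth (bud_inp X) i = Some (bud_out Y) ->
  onth (inp (bud_op X)) i = Some (out (bud_op Y)).
Proof.
move=> h; have: (i < size (inp (bud_op X)))%N.
  by rewrite -size_bud_inp -onthTE h.
by rewrite -onthTE; case: onth => // -[]; case: (out _).
Qed.

Lemma val_bud_pcomp X i Y : onth (bud_inp X) i = Some (bud_out Y) ->
  val (bud_pcomp X i Y) = (bud_out X, pcomp (bud_op X) i (bud_op Y),
                           subst_letter (bud_inp X) i (bud_inp Y)).
Proof.
move=> h; rewrite /bud_pcomp insubdK // unfold_in /=.
have h' := bud_composable h; rewrite /arity inp_pcomp //.
by rewrite !size_subst_letter -?onthTE ?h ?h' // !size_bud_inp.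
Qed.

Lemma bud_inp_gt0 X : (0 < size (bud_inp X))%N.
Proof. by rewrite size_bud_inp inp_gt0. Qed.

Lemma bud_out_pcomp X i Y : onth (bud_inp X) i = Some (bud_out Y) ->
  bud_out (bud_pcomp X i Y) = bud_out X.
Proof. by move=> h; rewrite {1}/bud_out val_bud_pcomp. Qed.

Lemma bud_op_pcomp X i Y : onth (bud_inp X) i = Some (bud_out Y) ->
  bud_op (bud_pcomp X i Y) = pcomp (bud_op X) i (bud_op Y).
Proof. by move=> h; rewrite {1}/bud_op val_bud_pcomp. Qed.

Lemma bud_inp_pcomp X i Y : onth (bud_inp X) i = Some (bud_out Y) ->
  bud_inp (bud_pcomp X i Y) = subst_letter (bud_inp X) i (bud_inp Y).
Proof. by move=> h; rewrite {1}/bud_inp val_bud_pcomp. Qed.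

Lemma bud_eq X Y : bud_out X = bud_out Y -> bud_op X = bud_op Y ->
  bud_inp X = bud_inp Y -> X = Y.
Proof.
rewrite /bud_out /bud_op /bud_inp => e1 e2 e3; apply: val_inj.
by case: (val X) (val Y) e1 e2 e3 => [[a x] u] [[b y] v] /= -> -> ->.
Qed.

Lemma onth_subst_letter_r (A : eqType) (u : seq A) i a v j b :
  onth u i = Some a -> onth v j = Some b ->
  onth (subst_letter u i v) (i + j) = Some b.
Proof.
move=> /onth_split[u1 [u2 [-> <-]]] h; rewrite subst_letter_cat onth_cat.
by rewrite ltnNge leq_addr /= addKn onth_cat -onthTE h.
Qed.

Lemma onth_subst_letter_lt (A : eqType) (u : seq A) i a v j b : (i < j)%N ->
  onth u i = Some a -> onth u j = Some b ->
  onth (subst_letter u j v) i = Some a.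
Proof.
move=> ij ha /onth_split[u1 [u2 [eu su1]]]; move: ha.
by rewrite eu -su1 subst_letter_cat !onth_cat su1 ij.
Qed.

Lemma onth_subst_letter_gt (A : eqType) (u : seq A) i a v j b : (i < j)%N ->
  (0 < size v)%N -> onth u i = Some a -> onth u j = Some b ->
  onth (subst_letter u i v) (j + (size v).-1) = Some b.
Proof.
move=> ij v0 /onth_split[u1 [u2 [-> su1]]]; rewrite -su1 in ij *.
rewrite subst_letter_cat catA onth_cat ltnNge ltnW //=.
rewrite -[(j - size u1)%N]prednK ?subn_gt0 //= => <-.
rewrite onth_cat size_cat ltnNge (_ : (_ <= _)%N) /=; last by lia.
by congr onth; lia.
Qed.

Lemma bud_pcomp_series X i Y j Z :
  onth (bud_inp X) i = Some (bud_out Y) ->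
  onth (bud_inp Y) j = Some (bud_out Z) ->
  bud_pcomp (bud_pcomp X i Y) (i + j)%N Z = bud_pcomp X i (bud_pcomp Y j Z).
Proof.
move=> h1 h2.
have h3 : onth (bud_inp (bud_pcomp X i Y)) (i + j) = Some (bud_out Z).
  by rewrite bud_inp_pcomp //; apply: onth_subst_letter_r h1 h2.
have h4 : onth (bud_inp X) i = Some (bud_out (bud_pcomp Y j Z)).
  by rewrite bud_out_pcomp.
apply: bud_eq.
- by rewrite !bud_out_pcomp.
- by rewrite !bud_op_pcomp // pcomp_series //; apply: bud_composable.
- rewrite (bud_inp_pcomp h3) (bud_inp_pcomp h4) (bud_inp_pcomp h1).
  rewrite (bud_inp_pcomp h2); exact: subst_letter_series h1 h2.
Qed.

Lemma bud_pcomp_parallel X i Y j Z : (i < j)%N ->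
  onth (bud_inp X) i = Some (bud_out Y) ->
  onth (bud_inp X) j = Some (bud_out Z) ->
  bud_pcomp (bud_pcomp X j Z) i Y =
  bud_pcomp (bud_pcomp X i Y) (j + (size (bud_inp Y)).-1)%N Z.
Proof.
move=> ij h1 h2; have v0 := bud_inp_gt0 Y.
have h3 : onth (bud_inp (bud_pcomp X j Z)) i = Some (bud_out Y).
  by rewrite bud_inp_pcomp //; apply: onth_subst_letter_lt ij h1 h2.
have h4 : onth (bud_inp (bud_pcomp X i Y)) (j + (size (bud_inp Y)).-1)
          = Some (bud_out Z).
  by rewrite bud_inp_pcomp //; apply: onth_subst_letter_gt ij v0 h1 h2.
apply: bud_eq.
- by rewrite !bud_out_pcomp.
- rewrite !bud_op_pcomp // size_bud_inp.
  by rewrite pcomp_parallel //; apply: bud_composable.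
- rewrite (bud_inp_pcomp h3) (bud_inp_pcomp h4) (bud_inp_pcomp h1).
  rewrite (bud_inp_pcomp h2); exact: subst_letter_parallel ij v0 h1 h2.
Qed.

Lemma bud_pcomp_onel X : bud_pcomp (bud_one (bud_out X)) 0 X = X.
Proof.
have h : onth (bud_inp (bud_one (bud_out X))) 0 = Some (bud_out X) by [].
apply: bud_eq.
- by rewrite bud_out_pcomp.
- rewrite bud_op_pcomp // -[RHS]pcomp_onel; congr pcomp.
  by rewrite /bud_op /=; case: (out _).
- by rewrite bud_inp_pcomp // /subst_letter /= cats0.
Qed.

Lemma bud_pcomp_oner X i a : onth (bud_inp X) i = Some a ->
  bud_pcomp X i (bud_one a) = X.
Proof.
move=> h; have h' : onth (bud_inp X) i = Some (bud_out (bud_one a)) by [].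
apply: bud_eq.
- by rewrite bud_out_pcomp.
- rewrite bud_op_pcomp // pcomp_oner //.
  by have := bud_composable h'; rewrite /= /bud_op /= out_one.
- by rewrite bud_inp_pcomp // subst_letter1.
Qed.

Definition Bud : coperad C :=
  @Coperad C bud_elt bud_out bud_inp bud_pcomp bud_one
    bud_inp_gt0 bud_out_pcomp bud_inp_pcomp (fun=> erefl) (fun=> erefl)
    bud_pcomp_series bud_pcomp_parallel bud_pcomp_onel bud_pcomp_oner.

End Bud.

Record bud_system := BudSystem {
  ground : operad;
  colors : finType;
  rules : set (Bud colors ground);
  rules_finite : finite_set rules;
  initial : {set colors};
  terminal : {set colors} }.

Arguments rules : clear implicits.

Definition nonempty_word_on (C : finType) (T : {set C}) (w : seq C) : bool :=
  (w != [::]) && all [in T] w.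

Section Synt.
Variables (K : fieldType) (B : bud_system).

Definition rseries : opseries K (Bud (colors B) (ground B)) :=
  char_series K (rules B).
Definition iseries : opseries K (Bud (colors B) (ground B)) :=
  char_series K (units_in (Bud (colors B) (ground B)) (initial B)).
Definition tseries : opseries K (Bud (colors B) (ground B)) :=
  char_series K (units_in (Bud (colors B) (ground B)) (terminal B)).

Definition synt : opseries K (Bud (colors B) (ground B)) :=
  oprod (oprod iseries (oinv (useries \- rseries))) tseries.

Definition synt_trees : set (tree (colors B) (Bud (colors B) (ground B))) :=
  [set t | [/\ Free (rules B) t, tout t \in initial B &
               nonempty_word_on (terminal B) (tin t)]].

End Synt.

Arguments rseries : clear implicits.
Arguments iseries : clear implicits.
Arguments tseries : clear implicits.
Arguments synt : clear implicits.
Arguments synt_trees : clear implicits.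

(* Main.v *)
Require Import Defs.
From mathcomp Require Import all_boot all_order all_algebra.
From mathcomp Require Import all_classical.
From mathcomp Require Import zify.

(** The argument takes place in a locally finite colored operad [O], with a set
    [S] of elements of [O] such that [arity1 S] finitely factorizes [O]; it
    applies to bud operads by [Bud_locally_finite].  Write [s] for the
    characteristic series of [S], [u] for the unit series, and [g] for the formal
    sum of the evaluations of the trees of [Free S].

    Every tree on [arity1 S] evaluates to an element of arity 1.  There are
    finitely many such elements, so there are finitely many trees on [arity1 S],
    and their heights are bounded.  In a composition [x = y o [z_1, ..., z_n]]
    with [y] in [S], each [z_i] has a smaller arity than [x], unless [y] has
    arity 1; and chains of factors [y] of arity 1 are trees on [arity1 S].  Hence
    passing from [x] to the [z_i] is a well-founded process.  This is the
    induction principle [factor_ind], and it has two consequences: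
    - [finite_ev_fibers]: each [x] is the evaluation of finitely many trees of
      [Free S], so that [g] makes sense;
    - [oprod_cancel]: left composition by [u - s] is injective, because
      [a = (u - s) (.) a + s (.) a] determines [a x] from the values of [a] at
      the factors of [x].

    Splitting a tree at its root gives [g = u + s (.) g] ([tree_series_eq]), i.e.
    [(u - s) (.) g = u].  The product is linear in its left argument only, so
    that [g] still has to be shown to be a left inverse: by associativity
    ([oprodA]), [(u - s) (.) (g (.) (u - s)) = u - s = (u - s) (.) u], and
    [oprod_cancel] applies.  The same lemma gives the uniqueness of the inverse.
    Finally, composing with the series of a set of units on the left or on the
    right restricts the output or the input colors
    ([oprod_units_inl], [oprod_units_inr]). *)

Set Implicit Arguments.
Unset Strict Implicit.
Unset Printing Implicit Defensive.

Import GRing.Theory.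
Local Open Scope classical_set_scope.
Local Open Scope ring_scope.

(* These names would otherwise refer to the composition of partial functions and
   to a base point of a bi-pointed type. *)
Local Notation pcomp := Defs.pcomp.
Local Notation one := Defs.one.

(** * Sums over finite sets *)

Lemma pair_fsum_dep (V : nmodType) (I J : choiceType) (A : set I)
    (B : I -> set J) (F : I -> J -> V) :
  finite_set A -> (forall i, A i -> finite_set (B i)) ->
  \sum_(i \in A) \sum_(j \in B i) F i j = \sum_(p \in A `*`` B) F p.1 p.2.
Proof.
move=> Afin Bfin.
have Ufin : finite_set (\bigcup_(i in A) B i) by apply: bigcup_finite.
transitivity (\sum_(i \in A) \sum_(j \in \bigcup_(i in A) B i)
                if j \in B i then F i j else 0).
  apply: eq_fsbigr => i; rewrite inE => Ai.
  rewrite -fsbig_mkcondr; apply: eq_fsbigl.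
  by apply/seteqP; split=> j => [Bj|[]//]; split=> //; exists i.
rewrite (pair_fsbig _ (fun i j => if j \in B i then F i j else 0)) //.
transitivity (\sum_(p \in A `*` \bigcup_(i in A) B i)
                if p \in [set p | B p.1 p.2] then F p.1 p.2 else 0).
  by apply: eq_fsbigr => p _; congr (if _ then _ else _).
rewrite -fsbig_mkcondr; apply: eq_fsbigl.
by apply/seteqP; split=> -[i j] /= [] => [[Ai _]|Ai Bj] //; split=> //; split=> //; exists i.
Qed.

Section Fibers.
Variables (I J : choiceType) (P : set J) (e : J -> I).

(** The elements of [P] over [w], for [e : J -> I]. *)
Definition fiber (w : I) : set J := [set p | P p /\ e p = w].

(** The words on [P] which lie letter by letter over the word [ws]; that is, the
    product of the fibers over the letters of [ws]. *)
Definition fibers (ws : seq I) : set (seq J) :=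
  [set ps | (forall p, p \in ps -> P p) /\ map e ps = ws].

Lemma fibers_nil : fibers [::] = [set [::]].
Proof. by apply/seteqP; split=> [[|p ps] []|_ ->]. Qed.

Lemma fibers_cons w ws :
  fibers (w :: ws) = (fun q => q.1 :: q.2) @` (fiber w `*` fibers ws).
Proof.
apply/seteqP; split=> [[|p ps] [] //= Pps [<- <-]|_ [[p ps] [/= [Pp <-] [Pps <-]] <-]].
  exists (p, ps) => //=; split; split=> //; first by apply: Pps; rewrite mem_head.
  by move=> q qps; apply: Pps; rewrite inE qps orbT.
by split=> // q; rewrite inE => /predU1P[-> //|/Pps].
Qed.

Lemma finite_fibers ws :
  (forall w, w \in ws -> finite_set (fiber w)) -> finite_set (fibers ws).
Proof.
elim: ws => [|w ws IH] wsfin; first by rewrite fibers_nil; apply: finite_set1.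
rewrite fibers_cons; apply/finite_image/finite_setX.
  by apply: wsfin; rewrite mem_head.
by apply: IH => v vws; apply: wsfin; rewrite inE vws orbT.
Qed.

(** Distributivity of a product over sums indexed by fibers. *)
Lemma prod_fsum_fibers (R : idomainType) (F : J -> R) ws :
  (forall w, w \in ws -> finite_set (fiber w)) ->
  \prod_(w <- ws) \sum_(p \in fiber w) F p =
  \sum_(ps \in fibers ws) \prod_(p <- ps) F p.
Proof.
elim: ws => [|w ws IH] wsfin.
  by rewrite fibers_nil fsbig_set1 !big_nil.
have wfin : finite_set (fiber w) by apply: wsfin; rewrite mem_head.
have {}wsfin v : v \in ws -> finite_set (fiber v).
  by move=> vws; apply: wsfin; rewrite inE vws orbT.
rewrite big_cons IH // fibers_cons fsbig_image; last first.
  by move=> [p ps] [q qs] _ _ /= [-> ->].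
under [RHS]eq_fsbigr do rewrite big_cons.
rewrite -(pair_fsbig _ (fun p ps => F p * \prod_(p <- ps) F p)) //; last first.
  exact: finite_fibers.
by rewrite mulr_fsuml; apply: eq_fsbigr => p _; rewrite mulr_fsumr.
Qed.

End Fibers.

(** The words of length [n] are those lying over a constant word of length [n],
    for the constant map to [unit]. *)
Lemma finite_words (I : choiceType) (A : set I) n : finite_set A ->
  finite_set [set s : seq I | size s = n /\ (forall x, x \in s -> A x)].
Proof.
move=> Afin; apply: (@sub_finite_set _ _ (fibers A (fun=> tt) (nseq n tt))).
  by move=> s [<- sA]; split=> //; elim: s {sA} => //= x s ->.
by apply: finite_fibers => w _; apply: sub_finite_set Afin => x [].
Qed.

(** * The complete composition *)

Section Composition.
Variables (C : finType) (O : coperad C).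
Implicit Types (x y z : O) (ys zs : seq O) (pre post : seq C).

(** The complete composition [ccomp] with the grafting positions shifted by [k]:
    [ys] is grafted on the inputs [k, k + 1, ...] of [x], from right to left.
    The shift makes inductions on [ys] possible. *)
Definition ccomp_from (k : nat) x ys : O :=
  foldr (fun iy acc => pcomp acc iy.1 iy.2) x (zip (iota k (size ys)) ys).

Lemma ccomp_from_cons k x y ys :
  ccomp_from k x (y :: ys) = pcomp (ccomp_from k.+1 x ys) k y.
Proof. by []. Qed.

Lemma ccomp_from_cat k x ys zs :
  ccomp_from k x (ys ++ zs) = ccomp_from k (ccomp_from (k + size ys)%N x zs) ys.
Proof.
by rewrite /ccomp_from size_cat iotaD zip_cat ?size_iota // foldr_cat.
Qed.

Lemma onth_mid pre a post : onth (pre ++ a :: post) (size pre) = Some a.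
Proof. by rewrite onth_cat ltnn subnn. Qed.

Lemma out_inp_ccomp_from x pre post ys :
  inp x = pre ++ map (@out C O) ys ++ post ->
  out (ccomp_from (size pre) x ys) = out x /\
  inp (ccomp_from (size pre) x ys) = pre ++ flatten (map (@inp C O) ys) ++ post.
Proof.
elim: ys pre => [|y ys IH] pre ex //=.
have [|eo ei] := IH (rcons pre (out y)); first by rewrite cat_rcons.
rewrite size_rcons cat_rcons in eo ei.
rewrite ccomp_from_cons.
have h : onth (inp (ccomp_from (size pre).+1 x ys)) (size pre) = Some (out y).
  by rewrite ei onth_mid.
rewrite out_pcomp // inp_pcomp // eo ei; split=> //.
by rewrite subst_letter_cat -catA.
Qed.

Lemma out_ccomp x ys : map (@out C O) ys = inp x -> out (ccomp x ys) = out x.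
Proof.
by move=> e; have [] // := @out_inp_ccomp_from x [::] [::] ys; rewrite cats0.
Qed.

Lemma inp_ccomp x ys : map (@out C O) ys = inp x ->
  inp (ccomp x ys) = flatten (map (@inp C O) ys).
Proof.
move=> e; have [] := @out_inp_ccomp_from x [::] [::] ys; first by rewrite cats0.
by move=> _ /=; rewrite cats0.
Qed.

(** Grafting [y] at [i] commutes with grafting [zs] further to the right, whose
    position is shifted by [size (inp y) - 1] once [y] is in place. *)
Lemma ccomp_from_parallel x i y zs post pre : (i < size pre)%N ->
  onth pre i = Some (out y) ->
  inp x = pre ++ map (@out C O) zs ++ post ->
  ccomp_from (size pre + (size (inp y)).-1)%N (pcomp x i y) zs =
  pcomp (ccomp_from (size pre) x zs) i y.
Proof.
elim: zs pre => [|z zs IH] pre // ipre hi ex.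
have ip : (i < size (rcons pre (out z)))%N by rewrite size_rcons ltnS ltnW.
have hi' : onth (rcons pre (out z)) i = Some (out y).
  by rewrite -cats1 onth_cat ipre.
have ex' : inp x = rcons pre (out z) ++ map (@out C O) zs ++ post.
  by rewrite cat_rcons.
have := IH _ ip hi' ex'; rewrite size_rcons addSn => IHz.
rewrite !ccomp_from_cons IHz.
have [_ ei] := out_inp_ccomp_from ex'; rewrite size_rcons cat_rcons in ei.
by rewrite -pcomp_parallel // ei onth_cat ?ltnn ?subnn ?ipre.
Qed.

(** Grafting [zs] on inputs of [x o_k y] which come from [y] amounts to grafting
    [zs] on [y] first. *)
Lemma ccomp_from_series x k y pre post zs :
  onth (inp x) k = Some (out y) ->
  inp y = pre ++ map (@out C O) zs ++ post ->
  ccomp_from (k + size pre)%N (pcomp x k y) zs =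
  pcomp x k (ccomp_from (size pre) y zs).
Proof.
move=> hk; elim: zs pre => [|z zs IH] pre ey //.
have ey' : inp y = rcons pre (out z) ++ map (@out C O) zs ++ post.
  by rewrite cat_rcons.
have := IH _ ey'; rewrite size_rcons addnS => IHz.
rewrite !ccomp_from_cons IHz.
have [eo ei] := out_inp_ccomp_from ey'; rewrite size_rcons cat_rcons in eo ei.
by rewrite pcomp_series ?eo // ei onth_mid.
Qed.

(** [p.1 o [p.2]] is defined. *)
Definition composable (p : O * seq O) : Prop := map (@out C O) p.2 = inp p.1.

(** Here [ps] lists the pairs [(y_i, zs_i)], where [y_i] is grafted on [x] and the
    word [zs_i] on [y_i]. *)
Lemma ccomp_from_assoc x pre post (ps : seq (O * seq O)) :
  (forall p, p \in ps -> composable p) ->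
  inp x = pre ++ map (@out C O) (map fst ps) ++ post ->
  ccomp_from (size pre) (ccomp_from (size pre) x (map fst ps))
    (flatten (map snd ps)) =
  ccomp_from (size pre) x (map (fun p => ccomp p.1 p.2) ps).
Proof.
elim: ps pre => [|[y zs] ps IH] pre // psC ex /=.
have yC : map (@out C O) zs = inp y by apply: (psC (y, zs)); rewrite mem_head.
have {}psC p : p \in ps -> composable p.
  by move=> pps; apply: psC; rewrite inE pps orbT.
have ex' : inp x = rcons pre (out y) ++ map (@out C O) (map fst ps) ++ post.
  by rewrite cat_rcons.
have := IH _ psC ex'; rewrite size_rcons => IHp.
rewrite ccomp_from_cat !ccomp_from_cons -IHp.
set X := ccomp_from _ x _.
have [eo ei] := out_inp_ccomp_from ex'; rewrite size_rcons cat_rcons -/X in eo ei.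
(* Both sides are the first position to the right of the inputs of [y], once [y]
   is grafted. *)
have -> : (size pre + size zs)%N =
    (size (rcons pre (out y)) + (size (inp y)).-1)%N.
  rewrite size_rcons -yC size_map; have := inp_gt0 y; rewrite -yC size_map; lia.
have eX : inp X = rcons pre (out y) ++ map (@out C O) (flatten (map snd ps)) ++ post.
  rewrite ei cat_rcons; congr (_ ++ _ :: _ ++ _); rewrite -map_comp map_flatten -map_comp.
  by congr flatten; apply/eq_in_map => p /psC.
rewrite (ccomp_from_parallel _ _ eX) ?size_rcons //; last first.
  by rewrite -cats1 onth_mid.
have [eo' ei'] := out_inp_ccomp_from eX; rewrite size_rcons cat_rcons in eo' ei'.
have := @ccomp_from_series (ccomp_from (size pre).+1 X (flatten (map snd ps))) (size pre) y
  [::] [::] zs.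
by rewrite addn0; apply; rewrite ?ei' ?onth_mid ?cats0.
Qed.

(** Associativity of the complete composition. *)
Lemma ccomp_assoc x (ps : seq (O * seq O)) :
  (forall p, p \in ps -> composable p) -> composable (x, map fst ps) ->
  ccomp (ccomp x (map fst ps)) (flatten (map snd ps)) =
  ccomp x (map (fun p => ccomp p.1 p.2) ps).
Proof.
move=> psC xC; apply: (@ccomp_from_assoc x [::] [::] ps) => //.
by rewrite cats0.
Qed.

Lemma ccomp_onel x : ccomp (one (out x)) [:: x] = x.
Proof. exact: pcomp_onel. Qed.

Lemma ccomp_oner x : ccomp x (map one (inp x)) = x.
Proof.
suff H u pre : inp x = pre ++ u -> ccomp_from (size pre) x (map one u) = x.
  exact: (H _ [::]).
elim: u pre => [|a u IH] pre ex //=.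
rewrite ccomp_from_cons -(size_rcons pre a) IH ?cat_rcons //.
by apply: pcomp_oner; rewrite ex onth_mid.
Qed.

End Composition.

(** * Factorizations and trees *)

Section Factorizations.
Variables (C : finType) (O : coperad C).
Implicit Types (x y z : O) (ys zs : seq O).

(** The index set of the composition product at [x]. *)
Definition factorizations x : set (O * seq O) :=
  [set p | composable p /\ ccomp p.1 p.2 = x].

Lemma arity_ccomp y zs : composable (y, zs) ->
  arity (ccomp y zs) = (\sum_(z <- zs) arity z)%N.
Proof.
move=> yC; rewrite /arity inp_ccomp // size_flatten /shape -map_comp sumnE.
by rewrite big_map.
Qed.

Lemma size_composable y zs : composable (y, zs) -> size zs = arity y.
Proof. by move=> /= /(congr1 size); rewrite size_map. Qed.

Lemma leq_arity_head y zs : composable (y, zs) ->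
  (arity y <= arity (ccomp y zs))%N.
Proof.
move=> yC; rewrite arity_ccomp // -(size_composable yC) -sum1_size.
by apply: leq_sum => z _; apply: inp_gt0.
Qed.

(** A factor [z] is strictly smaller in arity than the composition as soon as
    [y] has arity at least 2. *)
Lemma arity_factor y zs z : composable (y, zs) -> z \in zs ->
  (arity z + (arity y).-1 <= arity (ccomp y zs))%N.
Proof.
move=> yC zzs; rewrite arity_ccomp // -(size_composable yC).
rewrite (perm_big _ (perm_to_rem zzs)) big_cons leq_add2l -(size_rem zzs).
by rewrite -sum1_size; apply: leq_sum => w _; apply: inp_gt0.
Qed.

Hypothesis Ofin : locally_finite O.

Lemma finite_arity_le n : finite_set [set x : O | (arity x <= n)%N].
Proof.
apply: sub_finite_set (bigcup_finite (finite_II n.+1) (fun m _ => Ofin m)).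
by move=> x /= xn; exists (arity x).
Qed.

Lemma finite_factorizations x : finite_set (factorizations x).
Proof.
pose E := [set y : O | (arity y <= arity x)%N].
have Efin : finite_set E by apply: finite_arity_le.
apply: (sub_finite_set _ (finite_setX Efin (bigcup_finite (finite_II (arity x).+1)
  (fun n _ => finite_words n Efin)))) => -[y zs] [yC /= yx].
split=> /=; first by rewrite /E /= -yx leq_arity_head.
exists (size zs) => /=.
  by rewrite ltnS (size_composable yC) -yx leq_arity_head.
split=> // z zzs; rewrite /E /= -yx.
exact: leq_trans (leq_addr _ _) (arity_factor yC zzs).
Qed.

End Factorizations.

Section TreeEvaluation.
Variables (C : finType) (O : coperad C) (S : set O).

Lemma out_inp_ev t : Free S t -> out (ev t) = tout t /\ inp (ev t) = tin t.
Proof.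
elim=> [a|s ts _ ets _ IH] /=; first by rewrite out_one inp_one.
have sC : composable (s, map (@ev C O) ts).
  by rewrite /composable /= -ets -map_comp; apply/eq_in_map => u /IH[].
rewrite out_ccomp // inp_ccomp // -map_comp; split=> //; congr flatten.
by apply/eq_in_map => u /IH[].
Qed.

Lemma out_ev t : Free S t -> out (ev t) = tout t.
Proof. by case/out_inp_ev. Qed.

Lemma inp_ev t : Free S t -> inp (ev t) = tin t.
Proof. by case/out_inp_ev. Qed.

Lemma Free_node s ts : Free S (Node s ts) ->
  [/\ S s, composable (s, map (@ev C O) ts) & forall t, t \in ts -> Free S t].
Proof.
move E: (Node s ts) => t tF; case: tF E => // s' ts' s'S ets tsF [-> ->].
split=> //; rewrite /composable /= -ets -map_comp.
by apply/eq_in_map => t' /tsF /out_ev.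
Qed.

End TreeEvaluation.

Section Unary.
Variables (C : finType) (O : coperad C) (S : set O).
Hypothesis Ofin : locally_finite O.
Hypothesis S1fin : finitely_factorizes (arity1 S).

(** These trees evaluate to elements of arity 1, of which there are finitely
    many. *)
Lemma finite_Free_arity1 : finite_set [set t | Free (arity1 S) t].
Proof.
apply: sub_finite_set (bigcup_finite (Ofin 1) (fun x _ => S1fin x)) => t tF.
exists (ev t) => //=; rewrite /arity (inp_ev tF).
elim: tF => //= s ts [_ s1] ets _ IH.
move/(congr1 size): ets; rewrite size_map [size (inp s)]s1.
by case: ts IH => [|u [|]] //= IH _; rewrite cats0 IH // mem_head.
Qed.

(** The length of the leftmost branch; this is the height when all the nodes are
    unary. *)
Fixpoint spine (t : tree C O) : nat :=
  if t is Node _ ts then if ts is t' :: _ then (spine t').+1 else 1%N else 0%N.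

(** Well-founded induction on the right factors of the factorizations whose left
    factor is in [S]. *)
Lemma factor_ind (P : O -> Prop) :
  (forall x, (forall y zs, S y -> factorizations x (y, zs) ->
                forall z, z \in zs -> P z) -> P x) ->
  forall x, P x.
Proof.
move=> Pstep x; have [n] := ubnP (arity x); elim: n x => // n IHn x.
rewrite ltnS => xn; apply: contrapT => nPx.
(* If [P] fails at [x] and holds in smaller arities, then it fails at a right
   factor of the same arity, reached through an element of [arity1 S]; iterating
   gives trees on [arity1 S] of any height. *)
have chain k : exists2 t, Free (arity1 S) t & spine t = k.
  suff [t [tF _ tk]] : exists t,
      [/\ Free (arity1 S) t, tout t = out x & spine t = k] by exists t.
  elim: k x xn nPx => [|k IHk] x xn nPx.
    by exists (Leaf (out x)); split=> //; apply: FreeLeaf.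
  have [y [zs [z [yS [yC yx] zzs nPz]]]] : exists y zs z,
      [/\ S y, factorizations x (y, zs), z \in zs & ~ P z].
    apply: contrapT => noz; apply/nPx/Pstep => y zs yS yzs z zzs.
    by apply: contrapT => nPz; apply: noz; exists y, zs, z.
  have := arity_factor yC zzs; rewrite [ccomp _ _]yx => le_zx.
  have zn : (n <= arity z)%N.
    by rewrite leqNgt; apply/negP => /IHn.
  have y1 : arity y = 1%N.
    have y0 : (0 < arity y)%N := inp_gt0 y.
    move: (arity y) (arity x) (arity z) y0 le_zx xn zn; clear; lia.
  have [|t [tF tz tk]] := IHk z _ nPz; first by rewrite y1 addn0 in le_zx; apply: leq_trans xn.
  exists (Node y [:: t]); split=> /=; last by rewrite tk.
    apply: FreeNode => //=; last by move=> t'; rewrite inE => /eqP->.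
    have := size_composable yC; rewrite y1.
    case: zs zzs yC {yx} => [|z' [|]] //=; rewrite inE => /eqP<-.
    by rewrite /composable /= tz.
  by rewrite -yx out_ccomp.
have /finite_seqP[s Es] := finite_Free_arity1.
have [t tF tk] := chain (\max_(t <- s) spine t).+1.
have : t \in s by have : [set t | Free (arity1 S) t] t by []; rewrite Es.
by move=> ts; have := leq_bigmax_seq (F := spine) (P := predT) t ts isT; rewrite tk ltnn.
Qed.

(** Each element is the evaluation of finitely many trees. *)
Lemma finite_ev_fibers x : finite_set (fiber (Free S) (@ev C O) x).
Proof.
elim/factor_ind: x => x IH.
pose N (p : O * seq O) : set (tree C O) :=
  Node p.1 @` (if pselect (S p.1) then fibers (Free S) (@ev C O) p.2 else set0).
have Nfin p : factorizations x p -> finite_set (N p).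
  case: p => y zs px; apply: finite_image => /=.
  by case: pselect => //= yS; apply: finite_fibers => z; apply: IH yS px z.
have Lfin : finite_set (range (@Leaf C O)) by apply/finite_image/finite_finset.
apply: (@sub_finite_set _ _ (range (@Leaf C O) `|` \bigcup_(p in factorizations x) N p)).
  case=> [a|s ts] [tF ex]; first by left; exists a.
  right; have [sS sC tsF] := Free_node tF.
  exists (s, map (@ev C O) ts) => //; exists ts => //=; case: pselect => //.
rewrite finite_setU; split=> //; apply: bigcup_finite => //.
exact: finite_factorizations.
Qed.

End Unary.

(** * The composition product *)

Lemma eq_map_zip (T1 T2 T3 : eqType) (F : T1 -> T3) (G : T2 -> T3) s t :
  map F s = map G t -> forall p, p \in zip s t -> F p.1 = G p.2.
Proof.
elim: s t => [|a s IH] [|b t] //= [ab st] p; rewrite inE => /predU1P[-> //|].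
exact: IH.
Qed.

Section CompositionProduct.
Variables (K : fieldType) (C : finType) (O : coperad C).
Implicit Types (f g h : opseries K O) (x y z : O) (A : {set C}).

Lemma mem_units_in A x : (x \in units_in O A) = (out x \in A) && (x == one (out x)).
Proof.
apply/idP/andP; rewrite inE; first by move=> [a aA <-]; rewrite out_one.
by move=> [xA /eqP ->]; exists (out x) => //; rewrite out_one.
Qed.

Lemma units_inT : units_in O [set: C] = units O.
Proof. by apply/seteqP; split=> x [a _ <-]; exists a => //=; rewrite inE. Qed.

(** Only the factorization [x = 1 o [x]] contributes. *)
Lemma oprod_units_inl A g x :
  oprod (char_series K (units_in O A)) g x = (out x \in A)%:R * g x.
Proof.
rewrite /oprod -(fsbig_widen [set (one (out x), [:: x])]) /=.
- rewrite fsbig_set1 /= big_seq1 /char_series mem_units_in out_one eqxx.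
  by rewrite andbT.
- by move=> p -> /=; rewrite inp_one /= ccomp_onel.
- move=> [y zs] /= [[yC yx] ne]; rewrite /char_series mem_units_in.
  case: (eqVneq y (one (out y))) => [ey|]; last by rewrite andbF mul0r.
  case: ne; move: yC yx; rewrite ey inp_one; case: zs => [|z [|]] //= [<-].
  by rewrite ccomp_onel => ->.
Qed.

(** Only the factorization [x = x o [1, ..., 1]] contributes. *)
Lemma oprod_units_inr A f x :
  oprod f (char_series K (units_in O A)) x = f x * (all [in A] (inp x))%:R.
Proof.
have prodE zs : \prod_(z <- zs) char_series K (units_in O A) z =
    (all (mem (units_in O A)) zs)%:R.
  elim: zs => [|z zs IH]; first by rewrite big_nil.
  by rewrite big_cons IH /char_series -natrM mulnb.
rewrite /oprod -(fsbig_widen [set (x, map one (inp x))]) /=.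
- rewrite fsbig_set1 /= prodE all_map; congr (_ * (nat_of_bool _)%:R).
  by apply: eq_all => a /=; rewrite mem_units_in out_one eqxx andbT.
- move=> p -> /=; rewrite ccomp_oner -map_comp; split=> //.
  by rewrite -[RHS]map_id; apply: eq_map => a /=; rewrite out_one.
- move=> [y zs] /= [[yC yx] ne]; rewrite prodE.
  case: allP => [zsU|]; last by rewrite mulr0.
  case: ne; have ezs : zs = map one (inp y).
    rewrite -yC -map_comp -[LHS]map_id; apply/eq_in_map => z /zsU /=.
    by rewrite mem_units_in => /andP[_ /eqP].
  by rewrite -yx ezs ccomp_oner.
Qed.

Lemma oprod1l g : oprod useries g = g.
Proof.
by apply/funext => x; rewrite /useries -units_inT oprod_units_inl inE mul1r.
Qed.

Lemma oprod1r f : oprod f useries = f.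
Proof.
apply/funext => x; rewrite /useries -units_inT oprod_units_inr.
by rewrite (eq_all (a2 := predT)) ?all_predT ?mulr1 // => a; rewrite inE.
Qed.

Hypothesis Ofin : locally_finite O.

Lemma oprodDl f g h : oprod (f \+ g) h = oprod f h \+ oprod g h.
Proof.
apply/funext => x; rewrite /oprod /= -fsbig_split //=; last first.
  exact: (finite_factorizations Ofin).
by apply: eq_fsbigr => p _; rewrite mulrDl.
Qed.

(** Pairs made of a factorization [x = y o [u_1, ..., u_n]] and of a factorization
    [u_i = v_i o [zs_i]] of each [u_i]. *)
Definition nested_factorizations x : set (O * seq O * seq (O * seq O)) :=
  factorizations x `*`` (fun p => fibers (@composable C O)
                                    (fun q => ccomp q.1 q.2) p.2).

(** Such data correspond to the pairs of factorizations [x = w o [zs]] and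
    [w = y o [v_1, ..., v_n]], where [zs] is the concatenation of the [zs_i]. *)
Lemma set_bij_regroup x :
  set_bij (nested_factorizations x)
    (factorizations x `*`` (fun p => factorizations p.1))
    (fun Q => ((ccomp Q.1.1 (map fst Q.2), flatten (map snd Q.2)),
               (Q.1.1, map fst Q.2))).
Proof.
split.
- move=> [[y us] ps] [/= [yC yx] [psC psE]].
  have yC' : composable (y, map fst ps).
    rewrite /composable /= -yC -psE -!map_comp; apply/eq_in_map => q qps /=.
    by rewrite out_ccomp //; apply: psC.
  split=> //=; split; last by rewrite ccomp_assoc // psE.
  rewrite /composable /= inp_ccomp // map_flatten -!map_comp; congr flatten.
  exact/eq_in_map.
- move=> [[y us] ps] [[y' us'] ps']; rewrite !inE /=.
  move=> [_ [/= psC psE]] [_ [/= psC' psE']] [_ ezs ey evs].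
  (* The lengths of the [zs_i] are the arities of the [v_i], so that their
     concatenation determines them. *)
  have eps : ps = ps'.
    rewrite -[ps]zip_unzip -[ps']zip_unzip /unzip1 evs; congr zip.
    apply: eq_from_flatten_shape => //.
    have shE rs : (forall q : O * seq O, q \in rs -> composable q) ->
        shape (map snd rs) = map (@arity C O) (map fst rs).
      move=> rsC; rewrite /shape -!map_comp; apply/eq_in_map => -[v zs] /rsC.
      exact: size_composable.
    by rewrite !shE // evs.
  by rewrite ey -psE -psE' eps.
- move=> [[w zs] [y vs]] /= [/= [wC wx] [yC yw]].
  (* The word [zs] is cut into blocks along the arities of the [v_i]. *)
  pose zss := reshape (map (@arity C O) vs) zs.
  have ezss : map (map (@out C O)) zss = map (@inp C O) vs.
    rewrite /zss map_reshape [map _ zs]wC -yw inp_ccomp //= .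
    rewrite -[RHS]flattenK; congr reshape.
    by rewrite /shape -map_comp.
  have szss : size zss = size vs.
    by have /(congr1 size) := ezss; rewrite !size_map.
  have e1 : map fst (zip vs zss) = vs by rewrite -/unzip1 unzip1_zip ?szss.
  have e2 : flatten (map snd (zip vs zss)) = zs.
    rewrite -/unzip2 unzip2_zip ?szss // reshapeKr //.
    rewrite -[size zs](size_map (@out C O)) [map _ zs]wC -yw inp_ccomp //.
    by rewrite size_flatten /shape -map_comp.
  have psC p : p \in zip vs zss -> composable p.
    by move=> /(eq_map_zip (esym ezss)).
  exists ((y, map (fun q => ccomp q.1 q.2) (zip vs zss)), zip vs zss) => /=.
    split=> //=; split.
      rewrite /composable /= -yC -[in RHS]e1 -!map_comp.
      by apply/eq_in_map => q /psC /= /out_ccomp.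
    by rewrite -ccomp_assoc ?e1 ?e2 ?yw.
  by rewrite e1 e2 yw.
Qed.

Lemma oprodA f g h : oprod f (oprod g h) = oprod (oprod f g) h.
Proof.
have Ffin := finite_factorizations Ofin.
apply/funext => x; apply/esym; rewrite /oprod.
under eq_fsbigr do rewrite mulr_fsuml.
rewrite (pair_fsum_dep (A := factorizations x) (B := fun p => factorizations p.1)
  (fun p q => f q.1 * (\prod_(z <- q.2) g z) * \prod_(z <- p.2) h z)) //.
rewrite (reindex_fsbig _ _ _ _ (set_bij_regroup x)) /=.
transitivity (\sum_(p \in factorizations x)
   \sum_(ps \in fibers (@composable C O) (fun q => ccomp q.1 q.2) p.2)
     f p.1 * \prod_(q <- ps) (g q.1 * \prod_(z <- q.2) h z)).
  rewrite pair_fsum_dep //; last first.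
    by move=> p _; apply: finite_fibers => w _; apply: Ffin.
  apply: eq_fsbigr => Q _; rewrite big_split /= big_flatten !big_map /= mulrA.
  by [].
apply: eq_fsbigr => p _; rewrite -mulr_fsumr; congr (_ * _).
by rewrite -prod_fsum_fibers // => w _; apply: Ffin.
Qed.

End CompositionProduct.

(** * The series of trees *)

(** The coefficient at [x] counts the indices [j] with [e j = x]. *)
Lemma sum_familyE (K : fieldType) (C : finType) (O : coperad C) (J : choiceType)
    (A : set J) (e : J -> O) x :
  sum_family K A e x = \sum_(j \in fiber A e x) (1 : K).
Proof.
rewrite /sum_family -(fsbig_widen (fiber A e x)) /=.
- by apply: eq_fsbigr => j; rewrite /char_series inE => -[_ <-]; rewrite mem_set.
- by move=> j [].
- move=> j [Aj nj] /=; rewrite /char_series memNset // => xj.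
  by apply: nj.
Qed.

Section TreeSeries.
Variables (K : fieldType) (C : finType) (O : coperad C) (S : set O).
Hypothesis Ofin : locally_finite O.
Hypothesis S1fin : finitely_factorizes (arity1 S).
Local Notation s := (char_series K S).
Local Notation g := (sum_family K (Free S) (@ev C O)).

(** Left cancellability of [u - s]: the values of [s (.) a] at [x] only involve
    those of [a] at right factors of [x]. *)
Lemma oprod_cancel (a b : opseries K O) :
  oprod (useries \- s) a = oprod (useries \- s) b -> a = b.
Proof.
move=> eab; apply/funext; elim/(factor_ind Ofin S1fin) => x IH.
have split c : c x = oprod (useries \- s) c x + oprod s c x.
  rewrite -[c in LHS]oprod1l -[RHS]/((_ \+ _) x) -oprodDl //.
  by congr oprod; apply/funext => y /=; rewrite subrK.
rewrite (split a) (split b) eab; congr (_ + _).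
apply: eq_fsbigr => -[y zs]; rewrite inE => yzs /=.
have [yS|nyS] := pselect (S y); last by rewrite /char_series memNset // !mul0r.
by congr (_ * _); apply: eq_big_seq => z; apply: (IH _ _ yS yzs).
Qed.

(** A tree is a leaf, or a root in [S] with a word of subtrees. *)
Lemma tree_series_eq : g = useries \+ oprod s g.
Proof.
have Tfin := finite_ev_fibers Ofin S1fin.
have Ffin := finite_factorizations Ofin.
apply/funext => x /=; rewrite sum_familyE.
(* The trees that are leaves, and the other ones. *)
pose L := [set t : tree C O | exists2 a, t = Leaf a & one a = x].
pose N := [set t : tree C O | fiber (Free S) (@ev C O) x t /\
                              exists y ts, t = Node y ts].
have eLN : fiber (Free S) (@ev C O) x = L `|` N.
  apply/seteqP; split=> [[a|y ts] [tF tx]|_ [[a -> ax]|[]//]].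
  - by left; exists a.
  - by right; split=> //; exists y, ts.
  - by split=> //; apply: FreeLeaf.
have [Lfin Nfin] : finite_set L /\ finite_set N by rewrite -finite_setU -eLN.
rewrite eLN fsbigU0 //; last by move=> t [[a ta _] [_ [y [ts]]]]; rewrite ta.
congr (_ + _).
  rewrite /useries -units_inT /char_series mem_units_in inE /=.
  have [ex|nex] := eqVneq x (one (out x)).
    have -> : L = [set Leaf (out x)].
      apply/seteqP; split=> [_ [a -> <-]|_ ->]; first by rewrite out_one.
      by exists (out x).
    by rewrite fsbig_set1.
  have -> : L = set0; last by rewrite fsbig_set0.
  by rewrite -subset0 => t [a _ ax]; move: nex; rewrite -ax out_one eqxx.
transitivity (\sum_(p \in factorizations x)
    \sum_(ts \in fibers (Free S) (@ev C O) p.2) s p.1); last first.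
  apply: eq_fsbigr => p _; under eq_bigr do rewrite sum_familyE.
  rewrite prod_fsum_fibers // mulr_fsumr; apply: eq_fsbigr => ts _.
  by rewrite big1_eq mulr1.
rewrite pair_fsum_dep //; last first.
  by move=> p _; apply: finite_fibers.
(* Only the left factors in [S] contribute; the corresponding terms are in
   bijection with the trees that are not leaves. *)
pose D := [set q : O * seq O * seq (tree C O) | S q.1.1 /\
  (factorizations x `*`` (fun p => fibers (Free S) (@ev C O) p.2)) q].
rewrite -(fsbig_widen D); last 2 first.
- by move=> q [].
- move=> q [qF nq] /=; rewrite /char_series memNset // => qS.
  by apply: nq.
rewrite (reindex_fsbig (fun q => Node q.1.1 q.2) D N).
  apply: eq_fsbigr => q; rewrite inE => -[qS _] /=.
  by rewrite /char_series mem_set.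
split.
- move=> [[y zs] ts] [/= yS [[/= yC yx] [tsF tsE]]].
  split; last by exists y, ts.
  split; last by rewrite /= tsE.
  apply: FreeNode => //; rewrite -yC -tsE -map_comp.
  by apply/eq_in_map => t /tsF /out_ev /=.
- move=> [[y zs] ts] [[y' zs'] ts']; rewrite !inE /=.
  by move=> [/= _ [_ [_ <-]]] [/= _ [_ [_ <-]]] [-> ->].
- move=> t [[tF tx] [y [ts et]]]; rewrite {t}et in tF tx *.
  have [yS yC tsF] := Free_node tF.
  by exists ((y, map (@ev C O) ts), ts).
Qed.

Lemma tree_series_inv : is_oinv (useries \- s) g.
Proof.
have fg : oprod (useries \- s) g = useries.
  apply/funext => x; apply: (addIr (oprod s g x)).
  rewrite -[LHS]/((_ \+ _) x) -oprodDl //.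
  have -> : (useries \- s) \+ s = useries :> opseries K O.
    by apply/funext => y /=; rewrite subrK.
  by rewrite oprod1l {1}tree_series_eq.
split=> //; apply: oprod_cancel.
by rewrite oprodA // fg oprod1l oprod1r.
Qed.

Lemma tree_series_inv_unique g' : is_oinv (useries \- s) g' -> g' = g.
Proof. by case=> fg' _; apply: oprod_cancel; rewrite fg' (proj1 tree_series_inv). Qed.

End TreeSeries.

Lemma Bud_locally_finite (C : finType) (O : operad) :
  locally_finite O -> locally_finite (Bud C O).
Proof.
move=> Ofin n.
have Wfin : finite_set [set u : seq C | size u = n /\ forall a, a \in u -> setT a].
  exact/finite_words/finite_finset.
have Tfin := finite_setX (finite_setX (@finite_finset C setT) (Ofin n)) Wfin.
(* An element of the bud operad is needed as the default value of [insubd]. *)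
have [[X _]|noX] := pselect (exists X : Bud C O, True); last first.
  rewrite (_ : [set _ | _] = set0) //.
  by apply/seteqP; split=> // X _; apply: noX; exists X.
apply: sub_finite_set (finite_image (fun p => insubd X p : Bud C O) Tfin) => Y /= Yn.
exists (val Y); last by rewrite valKd.
split=> /=; first by split=> //=; rewrite -Yn; exact/esym/size_bud_inp.
by split.
Qed.

Theorem theorem3p3p9 (K : fieldType) (charK : [pchar K] =i pred0)
    (B : bud_system)
    (Ofin : locally_finite (ground B))
    (R1fin : finitely_factorizes (arity1 (rules B))) :
  [/\ exists! g, is_oinv (useries \- rseries K B) g,
      summable_family (synt_trees B) (@ev _ _)
    & synt K B = sum_family K (synt_trees B) (@ev _ _)].
Proof.
have Bfin := @Bud_locally_finite (colors B) _ Ofin.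
pose g := sum_family K (Free (rules B)) (@ev _ (Bud (colors B) (ground B))).
have gP : is_oinv (useries \- rseries K B) g by apply: tree_series_inv.
have gU g' : is_oinv (useries \- rseries K B) g' -> g' = g.
  exact: tree_series_inv_unique.
split.
- by exists g; split=> // g' /gU.
- move=> x; apply: sub_finite_set (finite_ev_fibers Bfin R1fin x).
  by move=> t [[tF _ _] tx].
have -> : synt K B = oprod (oprod (iseries K B) g) (tseries K B).
  by congr (oprod (oprod _ _) _); apply: (xget_unique _ gP gU).
apply/funext => x.
rewrite /tseries /iseries oprod_units_inr oprod_units_inl /g !sum_familyE.
have [xI|xI] := boolP (out x \in initial B); last first.
  rewrite !mul0r (_ : fiber _ _ _ = set0) ?fsbig_set0 //.
  apply/seteqP; split=> // t [[tF tI _] tx].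
  by move: xI; rewrite -tx (out_ev tF) tI.
have [xT|xT] := boolP (all _ (inp x)); last first.
  rewrite mulr0 (_ : fiber _ _ _ = set0) ?fsbig_set0 //.
  apply/seteqP; split=> // t [[tF _ /andP[_ tT]] tx].
  by move: xT; rewrite -tx (inp_ev tF) tT.
rewrite mul1r mulr1; apply: eq_fsbigl; apply/seteqP; split=> t [].
  move=> tF tx; split=> //; split=> //; first by rewrite -(out_ev tF) tx.
  rewrite /nonempty_word_on -(inp_ev tF) tx xT andbT -size_eq0 -lt0n.
  exact: inp_gt0.
by move=> [tF _ _] tx; split.
Qed.
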